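(* Let $\nu\in(0,1]$, $t>t_0\ge0$, $n\in\mathbb{N}$, and let $\mathfrak{T}^\nu_t(x)=T(\mathfrak{B}^x_\nu(t))$ be the composition of a zero-mean, $n$-weakly isotropic, isotropic random field $T$ on $\mathbb{S}^2_1$ and an independent time-changed rotational Brownian motion $\mathfrak{B}^x_\nu$ started at $x$ at time $t_0$. Then for every $x\in\mathbb{S}^2_1$ and every $g\in SO(3)$, $$\mathbb{E}\big[(\mathfrak{T}^\nu_t(gx))^n\big]=\mathbb{E}\big[(T(x))^n\big].$$
   Context: $\mathbb{S}^2_1$ is the unit sphere in $\mathbb{R}^3$ with surface measure $\lambda$, $\triangle_{\mathbb{S}^2_1}$ the Laplace–Beltrami operator, $Y_{lm}$ ($l\ge0$, $|m|\le l$) the orthonormal complex spherical harmonics. Random field: $T=\{T(x):x\in\mathbb{S}^2_1\}$ is a real-valued (measurable) random field with $\mathbb{E}T(x)=0$, isotropic ($T(g\,\cdot)$ and $T(\cdot)$ have the same law for all $g\in SO(3)$), and $n$-weakly isotropic: $\mathbb{E}|T(gx)|^n<\infty$ for every $x$, and $\mathbb{E}[T(x_1)\cdots T(x_n)]=\mathbb{E}[T(gx_1)\cdots T(gx_n)]$ for all $x_1,\dots,x_n\in\mathbb{S}^2_1$ and $g\in SO(3)$. It also has finite variance and admits the spectral representation $T(x)=\sum_{l\ge0}\sum_{|m|\le l}a_{lm}Y_{lm}(x)$, $a_{lm}=\int_{\mathbb{S}^2_1}T(x)Y^*_{lm}(x)\lambda(dx)$, convergent in $L^2(P)$ for each $x$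 and in $L^2(P\otimes\lambda)$. Time-changed rotational Brownian motion: $\mathfrak{B}^x(t)$ is Brownian motion on $\mathbb{S}^2_1$ started at $x$ (the diffusion with generator $\triangle_{\mathbb{S}^2_1}$). For $\nu\in(0,1)$, $\mathfrak{H}^\nu_t$ is the stable subordinator with $\mathbb{E}e^{-s\mathfrak{H}^\nu_t}=e^{-ts^\nu}$ and $\mathfrak{L}^\nu_t=\inf\{\tau>0:\mathfrak{H}^\nu_\tau>t\}$, independent of $\mathfrak{B}^x$; $\mathfrak{L}^1_t=t$. Then $\mathfrak{B}^x_\nu(t)=\mathfrak{B}^x(\mathfrak{L}^\nu_{t-t_0})$, $t\ge t_0$. $T$ is independent of $\mathfrak{B}^x_\nu$.
   Formalization: Independence of T and the time-changed Brownian motion is taken in a stronger sense: T is jointly measurable for a sigma-algebra independent of the motion; with mere independence of the generated sigma-algebras the claim fails, e.g. for T(x)=1 if x is the position at time t, else 0. *)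

(* Defs.v *)
From HB Require Import structures.
From mathcomp Require Import all_boot all_order all_algebra.
From mathcomp Require Import all_classical all_reals all_analysis.
From mathcomp Require Import measurable_realfun complex.

Set Implicit Arguments.
Unset Strict Implicit.
Unset Printing Implicit Defensive.
Import Order.TTheory GRing.Theory Num.Theory.
Import numFieldNormedType.Exports.

Local Open Scope classical_set_scope.
Local Open Scope ring_scope.

(* The norm the library puts on 'cV[R]_3 is the sup norm, so the Euclidean one
   is written out. *)
Definition sqnorm (R : realType) (v : 'cV[R]_3) : R := \sum_i v i ord0 ^+ 2.

Definition sphere_set (R : realType) : set 'cV[R]_3 := [set v | sqnorm v = 1].
Arguments sphere_set : clear implicits.

Definition sphere (R : realType) : Type := set_type (sphere_set R).

Definition SO3 (R : realType) : Type :=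
  set_type [set g : 'M[R]_3 | g^T *m g = 1%:M /\ \det g = 1].

Lemma sqnormE (R : realType) (v : 'cV[R]_3) :
  sqnorm v = (v^T *m v) ord0 ord0.
Proof. by rewrite mxE; apply: eq_bigr => i _; rewrite mxE expr2. Qed.

Lemma so3_act_subproof (R : realType) (g : SO3 R) (x : sphere R) :
  val g *m val x \in sphere_set R.
Proof.
case: g => g /= /set_mem [gg _]; case: x => x /= /set_mem /= x1.
by apply/mem_set; rewrite /sphere_set /= sqnormE trmx_mul mulmxA
  -(mulmxA _ _ g) gg mulmx1 -sqnormE.
Qed.

Definition so3_act (R : realType) (g : SO3 R) (x : sphere R) : sphere R :=
  exist (fun v => v \in sphere_set R) (val g *m val x) (so3_act_subproof g x).

Lemma north_subproof (R : realType) :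
  (\col_(i < 3) (i == 2 :> nat)%:R : 'cV[R]_3) \in sphere_set R.
Proof.
apply/mem_set; rewrite /sphere_set /= /sqnorm !big_ord_recl big_ord0 !mxE /=.
by rewrite expr0n /= !add0r expr1n addr0.
Qed.

Definition north (R : realType) : sphere R :=
  exist (fun v => v \in sphere_set R) _ (north_subproof R).

HB.instance Definition _ (R : realType) := Choice.on (sphere R).
HB.instance Definition _ (R : realType) := isPointed.Build (sphere R) (north R).
HB.instance Definition _ (R : realType) := Topological.copy (sphere R)
  (set_type (sphere_set R)).

Lemma sqnorm_ge0 (R : realType) (v : 'cV[R]_3) : 0 <= sqnorm v.
Proof. by apply: sumr_ge0 => i _; exact: sqr_ge0. Qed.

Lemma sqnorm_eq0 (R : realType) (v : 'cV[R]_3) : (sqnorm v == 0) = (v == 0).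
Proof.
apply/idP/eqP => [|->]; last first.
  by rewrite /sqnorm big1// => i _; rewrite mxE expr0n.
rewrite psumr_eq0 => [/allP v0|i _]; last exact: sqr_ge0.
apply/colP => i; rewrite mxE; apply/eqP; rewrite -sqrf_eq0.
exact: (implyP (v0 i (mem_index_enum i))).
Qed.

Lemma direction_subproof (R : realType) (v : 'cV[R]_3) :
  (if v == 0 then val (north R) else (Num.sqrt (sqnorm v))^-1 *: v) \in
    sphere_set R.
Proof.
case: ifPn => [_|v0]; first exact: (valP (north R)).
apply/mem_set; rewrite /sphere_set /= /sqnorm.
under eq_bigr => i _ do rewrite mxE exprMn.
by rewrite -mulr_sumr exprVn sqr_sqrtr ?sqnorm_ge0// mulVf// sqnorm_eq0.
Qed.

(* v / |v|, with an irrelevant value at the origin. *)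
Definition direction (R : realType) (v : 'cV[R]_3) : sphere R :=
  exist (fun v => v \in sphere_set R) _ (direction_subproof v).

(* The Borel sigma-algebra of R^3 is generated by the three coordinates; as for
   tuples in the library, its trace on the sphere is defined that way. *)
Definition sphere_coord (R : realType) (i : 'I_3) (x : sphere R) : R :=
  val x i ord0.

Definition sphere_measurable (R : realType) : set (set (sphere R)) :=
  g_sigma_preimage (@sphere_coord R).

HB.instance Definition _ (R : realType) :=
  @isMeasurable.Build (sigma_display (@sphere_measurable R)) (sphere R)
    (@sphere_measurable R) (@sigma_algebra0 _ setT _) (@sigma_algebraC _ _)
    (@sigma_algebra_bigcup _ setT _).

Definition R3 (R : realType) : Type :=
  (measurableTypeR R * measurableTypeR R * measurableTypeR R)%type.

Definition vec3 (R : realType) (p : R3 R) : 'cV[R]_3 :=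
  \col_i [tuple p.1.1; p.1.2; p.2]`_i.

Section surface_measure.
Context (R : realType).

Lemma measurable_vec3 (i : 'I_3) :
  measurable_fun [set: R3 R] (fun p => vec3 p i ord0).
Proof.
under eq_fun do rewrite mxE.
case: i => [[|[|[|//]]] ?] /=.
- exact: (measurableT_comp measurable_fst measurable_fst).
- exact: (measurableT_comp measurable_snd measurable_fst).
- exact: measurable_snd.
Qed.

Lemma measurable_sqnorm_vec3 :
  measurable_fun [set: R3 R] (fun p => sqnorm (vec3 p)).
Proof.
apply: measurable_sum => i.
by apply: measurable_funX; exact: measurable_vec3.
Qed.

Lemma measurable_unit_ball :
  measurable [set p : R3 R | sqnorm (vec3 p) <= 1].
Proof.
rewrite -[X in measurable X]setTI.
exact: (measurable_sqnorm_vec3 measurableT (measurable_itv `]-oo, 1])).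
Qed.

Lemma measurable_direction_vec3 :
  measurable_fun [set: R3 R] (fun p => direction (vec3 p)).
Proof.
have coord i : measurable_fun [set: R3 R]
    (fun p => sphere_coord i (direction (vec3 p))).
  rewrite (_ : (fun p => _) = (fun p => if sqnorm (vec3 p) == 0
    then sphere_coord i (north R)
    else sqnorm (vec3 p) `^ (- 2^-1) * vec3 p i ord0)); last first.
    apply/funext => p; rewrite /sphere_coord /= powRN powR12_sqrt ?sqnorm_ge0//.
    by rewrite sqnorm_eq0; case: ifPn => // _; rewrite mxE.
  apply: measurable_fun_ifT => //.
    by apply: measurable_fun_eqr => //; exact: measurable_sqnorm_vec3.
  apply: measurable_funM; last exact: measurable_vec3.
  exact: (measurableT_comp (measurable_powR _) measurable_sqnorm_vec3).
apply: (measurability _ (erefl (@sphere_measurable R))) => _ [A + <-].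
rewrite -bigcup_seq => -[i _ [B mB <-]]; rewrite !setTI.
by rewrite -[X in measurable X]setTI; exact: coord.
Qed.

Local Open Scope ereal_scope.

Definition lebesgue3 : {measure set (R3 R) -> \bar R} :=
  (@lebesgue_measure R \x @lebesgue_measure R) \x @lebesgue_measure R.

(* Cone measure: 3 Leb^3 {v in the unit ball | v / |v| in A}. The factor 3 is
   the dimension; the total mass is 3 (4 pi / 3) = 4 pi. *)
Definition surface_measure (A : set (sphere R)) : \bar R :=
  3%:E * mrestr lebesgue3 measurable_unit_ball
           ((fun p : R3 R => direction (vec3 p)) @^-1` A).

Let cone_measure : {measure set (sphere R) -> \bar R} :=
  mscale 3%:nng%R
    (measure_function_pushforward__canonical__measure_function_Measure
    (mrestr lebesgue3 measurable_unit_ball) measurable_direction_vec3).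

Let surface_measureE : surface_measure = cone_measure.
Proof. by []. Qed.

Let surface_measure0 : surface_measure set0 = 0.
Proof. by rewrite surface_measureE measure0. Qed.

Let surface_measure_ge0 A : 0 <= surface_measure A.
Proof. by rewrite surface_measureE measure_ge0. Qed.

Let surface_measure_sigma_additive : semi_sigma_additive surface_measure.
Proof. by rewrite surface_measureE; exact: measure_semi_sigma_additive. Qed.

HB.instance Definition _ := isMeasure.Build _ _ _ surface_measure
  surface_measure0 surface_measure_ge0 surface_measure_sigma_additive.

Let lebesgue3_unit_ball :
  lebesgue3 [set p : R3 R | (sqnorm (vec3 p) <= 1)%R] < +oo.
Proof.
have mI : measurable (`[(-1)%R, 1%R] : set (measurableTypeR R)).
  exact: measurable_itv.
apply: (@le_lt_trans _ _ (lebesgue3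
    ((`[(-1)%R, 1%R] `*` `[(-1)%R, 1%R]) `*` `[(-1)%R, 1%R]))).
  apply: le_measure; rewrite ?inE.
  - exact: measurable_unit_ball.
  - by apply: measurableX => //; exact: measurableX.
  - move=> [[a b] c] /=.
    rewrite /sqnorm !big_ord_recl big_ord0 !mxE /= addr0 !in_itv/= -!ler_norml.
    move=> abc; have sq1 (u v : R) : (0 <= v -> u ^+ 2 + v <= 1 -> `|u| <= 1)%R.
      move=> v0 uv; rewrite -(@expr_le1 _ 2)// real_normK ?num_real//.
      by rewrite (le_trans _ uv)// lerDl.
    split; first split.
    + by apply: (sq1 _ _ _ abc); rewrite addr_ge0 ?sqr_ge0.
    + by apply: (sq1 _ (a ^+ 2 + c ^+ 2)%R); rewrite ?addr_ge0 ?sqr_ge0//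
        addrCA.
    + apply: (sq1 _ (a ^+ 2 + b ^+ 2)%R); rewrite ?addr_ge0 ?sqr_ge0//.
      by rewrite addrC -addrA.
have := product_measure1E ((@lebesgue_measure R \x @lebesgue_measure R))
  (@lebesgue_measure R) (measurableX mI mI) mI.
rewrite /lebesgue3/= => ->; rewrite product_measure1E//.
have lebI : lebesgue_measure (`[(-1)%R, 1%R] : set R) = (1 - - 1)%:E.
  by rewrite lebesgue_measure_itv/= lte_fin gtrN// EFinB.
by rewrite [X in X * _ * _]lebI [X in _ * X * _]lebI [X in _ * X]lebI
  -!EFinM ltry.
Qed.

Let surface_measure_fin : fin_num_fun surface_measure.
Proof.
move=> A mA; rewrite /surface_measure fin_numM// ge0_fin_numE//.
apply: le_lt_trans lebesgue3_unit_ball; rewrite /mrestr.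
apply: le_measure; rewrite ?inE.
- apply: measurableI; last exact: measurable_unit_ball.
  by rewrite -[X in measurable X]setTI; exact: measurable_direction_vec3.
- exact: measurable_unit_ball.
- exact: subIsetr.
Qed.

HB.instance Definition _ := Measure_isFinite.Build _ _ _ surface_measure
  surface_measure_fin.

End surface_measure.

(* A function on the sphere is extended to R^3 minus the origin, constant along
   rays; on the sphere the Euclidean Laplacian of the extension is the
   Laplace-Beltrami operator, the radial derivatives vanishing. *)
Definition radial_ext (R : realType) (f : sphere R -> R) (v : 'cV[R]_3) : R :=
  f (direction v).

Definition partial_deriv (R : realType) (i : 'I_3) (F : 'cV[R]_3 -> R)
  (v : 'cV[R]_3) : R := 'D_(delta_mx i ord0) F v.

Definition laplace_beltrami (R : realType) (f : sphere R -> R) (x : sphere R) :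
  R := \sum_(i < 3) partial_deriv i (partial_deriv i (radial_ext f)) (val x).

Definition sphere_C2 (R : realType) (f : sphere R -> R) : Prop :=
  forall (v : 'cV[R]_3) (i j : 'I_3), v != 0 ->
  [/\ derivable (radial_ext f) v (delta_mx i ord0),
      derivable (partial_deriv i (radial_ext f)) v (delta_mx j ord0) &
      {for v, continuous (partial_deriv j (partial_deriv i (radial_ext f)))}].

(* The orthonormal harmonics with the Condon-Shortley phase,
     Y_lm(x) = sqrt ((2l+1)/(4 pi) (l-m)!/(l+m)!) P_l^m(cos theta) e^{i m phi},
     P_l^m(u) = (-1)^m / (2^l l!) (1-u^2)^{m/2} (d/du)^{l+m} (u^2-1)^l,
   for 0 <= m <= l, in Cartesian coordinates: x_2 = cos theta and
   x_0 + i x_1 = sin theta e^{i phi}. *)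
Definition sph_harmonic_nneg (R : realType) (l m : nat) (x : sphere R) : R[i] :=
  ((-1) ^+ m
    * Num.sqrt ((2 * l + 1)%:R / (4%:R * pi) * (l - m)`!%:R / (l + m)`!%:R)
    * ((2 ^ l * l`!)%:R)^-1
    * (('X ^+ 2 - 1) ^+ l : {poly R})^`(l + m).[sphere_coord 2 x])%:C%C
  * (sphere_coord 0 x +i* sphere_coord 1 x)%C ^+ m.

(* Y_{l,-m} = (-1)^m (Y_lm)^*; here Negz k stands for -(k+1). *)
Definition sph_harmonic (R : realType) (l : nat) (m : int) (x : sphere R) :
  R[i] :=
  match m with
  | Posz k => sph_harmonic_nneg l k x
  | Negz k => (-1) ^+ k.+1 * ((sph_harmonic_nneg l k.+1 x)^*)%C
  end.

Definition sqmod (R : realType) (z : R[i]) : R :=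
  complex.Re z ^+ 2 + complex.Im z ^+ 2.

(* The sigma-algebra generated by (X_i), i in D. *)
Definition sigma_process (I Om : Type) (d : measure_display)
    (E : measurableType d) (D : set I) (X : I -> Om -> E) : set (set Om) :=
  <<s \bigcup_(i in D) preimage_set_system setT (X i) measurable >>.

Section random.
Context (R : realType) (d : measure_display) (Om : measurableType d)
  (P : probability Om R).

Definition indep_sigma (F G : set (set Om)) : Prop :=
  forall A B, F A -> G B -> P (A `&` B) = (P A * P B)%E.

Implicit Type T : sphere R -> Om -> R.

Definition measurable_field T : Prop :=
  measurable_fun [set: Om * sphere R] (fun p => T p.2 p.1).

Definition zero_mean T : Prop := forall x, ('E_P[T x] = 0)%E.

Definition finite_variance T : Prop := forall x, ('V_P[T x] < +oo)%E.

(* Equality of the laws of T and of x |-> T (g x) on the space of all functions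
   with its product (cylinder) sigma-algebra. *)
Definition isotropic T : Prop :=
  forall (g : SO3 R) (E : set (sphere R -> R)),
    sigma_process [set: sphere R] (fun x (f : sphere R -> R) => f x) E ->
    P [set w | E (fun x => T (so3_act g x) w)] = P [set w | E (fun x => T x w)].

Definition weakly_isotropic (n : nat) T : Prop :=
  (forall (g : SO3 R) (x : sphere R),
     ('E_P[fun w => (`|T (so3_act g x) w| ^+ n)%R] < +oo)%E) /\
  (forall (g : SO3 R) (x : 'I_n -> sphere R),
     ('E_P[fun w => (\prod_(i < n) T (x i) w)%R] =
      'E_P[fun w => (\prod_(i < n) T (so3_act g (x i)) w)%R])%E).

Definition sph_harmonic_coef T (l : nat) (m : int) (w : Om) : R[i] :=
  (
   (\int[@surface_measure R]_x (T x w * complex.Re (sph_harmonic l m x)^*%C))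
   +i*
   (\int[@surface_measure R]_x (T x w * complex.Im (sph_harmonic l m x)^*%C)))%C.

(* The terms with l < N; k - l runs over -l, ..., l. *)
Definition sph_harmonic_sum T (N : nat) (x : sphere R) (w : Om) : R[i] :=
  \sum_(l < N) \sum_(k < (2 * l).+1)
    sph_harmonic_coef T l (k%:Z - l%:Z) w * sph_harmonic l (k%:Z - l%:Z) x.

Definition spectral_representation T : Prop :=
  (forall x, (\int[P]_w (sqmod ((T x w)%:C%C - sph_harmonic_sum T N x w))%:E)%E
     @[N --> \oo] --> 0%E) /\
  (\int[P \x @surface_measure R]_p
     (sqmod ((T p.2 p.1)%:C%C - sph_harmonic_sum T N p.2 p.1))%:E)%E
     @[N --> \oo] --> 0%E.

(* The generator is Delta, not Delta / 2. *)
Definition heat_semigroup (p : R -> R.-pker sphere R ~> sphere R) : Prop :=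
  [/\ forall x A, measurable A -> p 0 x A = \d_x A,
      forall s t x A, 0 <= s -> 0 <= t -> measurable A ->
        p (s + t) x A = (\int[p s x]_y p t y A)%E &
      forall f, sphere_C2 f -> forall e, 0 < e ->
        \forall t \near 0^'+, forall x,
        `|((\int[p t x]_y f y) - f x) / t - laplace_beltrami f x| < e].

(* Continuous Markov process with generator laplace_beltrami, started at x; the
   time set is [0, +oo[. *)
Definition brownian (x : sphere R) (B : R -> Om -> sphere R) : Prop :=
  [/\ forall t, 0 <= t -> measurable_fun setT (B t),
      forall w, B 0 w = x,
      forall w, {within `[0, +oo[, continuous (fun t => B t w)} &
      exists2 p : R -> R.-pker sphere R ~> sphere R, heat_semigroup p &
        forall s t F A, 0 <= s -> 0 <= t ->
          sigma_process `[0, s] B F -> measurable A ->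
          P (F `&` B (s + t) @^-1` A) = (\int[P]_(w in F) p t (B s w) A)%E].

Definition stable_subordinator (nu : R) (H : R -> Om -> R) : Prop :=
  [/\ forall t, 0 <= t -> measurable_fun setT (H t),
      forall w, H 0 w = 0,
      forall w, (forall s t, 0 <= s -> s <= t -> H s w <= H t w) /\
        (forall t, 0 <= t -> H s w @[s --> t^'+] --> H t w),
      forall s t, 0 <= s -> s <= t ->
        indep_sigma (sigma_process `[0, s] H)
          (g_sigma_algebra_preimage (fun w => H t w - H s w)) /\
        (forall A, measurable A ->
          P [set w | A (H t w - H s w)] = P [set w | A (H (t - s) w)]) &
      forall s t, 0 <= s -> 0 <= t ->
        ('E_P[fun w => (expR (- (s * H t w)))%R] =
         (expR (- (t * s `^ nu)))%:E)%E].

(* The inverse of a nu-stable subordinator, and t itself for nu = 1. *)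
Definition inverse_subordinator (nu : R) (L : R -> Om -> R) : Prop :=
  (nu < 1 -> exists2 H, stable_subordinator nu H &
     forall t w, 0 <= t -> L t w = inf [set tau | 0 < tau /\ t < H tau w]) /\
  (nu = 1 -> forall t w, 0 <= t -> L t w = t).

Definition time_changed (t0 : R) (B : R -> Om -> sphere R) (L : R -> Om -> R)
  (t : R) (w : Om) : sphere R := B (L (t - t0) w) w.

Definition indep_processes dE (E : measurableType dE) dE'
    (E' : measurableType dE') (D D' : set R)
    (X : R -> Om -> E) (Y : R -> Om -> E') : Prop :=
  indep_sigma (sigma_process D X) (sigma_process D' Y).

(* Independence of the measurable field T and the process (X_s), s in D: T is
   jointly measurable with respect to a sigma-algebra G independent of X (for
   instance that of the first factor, if T and X live on the factors of a
   product space). Independence of the families (T x) and (X_s) alone would not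
   determine the law of w |-> T (X s w) w: for U uniform on the sphere,
   T x = 1_{x = U} generates only null and conull events for each x, so it would
   be independent of X_s = U, although T (X_s) = 1. *)
Definition indep_field (D : set R) T (X : R -> Om -> sphere R) : Prop :=
  exists G : set (set Om),
  [/\ sigma_algebra setT G, G `<=` measurable,
      measurable_fun [set: g_sigma_algebraType G * sphere R]
        (fun p => T p.2 p.1) &
      indep_sigma G (sigma_process D X)].

Definition composition T (B : sphere R -> R -> Om -> sphere R) (t : R)
  (x : sphere R) (w : Om) : R := T (B x t w) w.

End random.

(* Main.v *)
Require Import Defs.
From HB Require Import structures.
From mathcomp Require Import all_boot all_order all_algebra.
From mathcomp Require Import all_classical all_reals all_analysis.
From mathcomp Require Import measurable_realfun ring.

Set Implicit Arguments.
Unset Strict Implicit.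
Unset Printing Implicit Defensive.
Import Order.TTheory GRing.Theory Num.Theory.
Import numFieldNormedType.Exports.
Local Open Scope classical_set_scope.
Local Open Scope ring_scope.

(** Write y = g x and let X be the position at time t of the time-changed
    Brownian motion started at y. The value T(X) has the same law as T(x), and
    the equality of n-th moments is one consequence of that.

    Given X = z, independence makes T(X) distributed as T(z). The group SO(3)
    acts transitively on the sphere, so isotropy gives T(z) the same law for
    all z, and averaging this constant over the law of X leaves it unchanged:
    P(T(X) in A) = P(T(x) in A) for every Borel set A. The averaging is Tonelli's theorem for the joint law of X and of
    the sigma-algebra carrying T, which is a product measure
    ([prob_comp_indep]). Transitivity is obtained from half-turns
    ([so3_transitive]): the half-turn about the bisector of two points exchanges
    them.

    Equal laws give equal moments because the integrals of the positive and of
    the negative part of the n-th power are each determined by the law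
    ([expectation_comp_eq_law]).

    What remains is that X is a random variable: without it the law of X is not
    a measure on the Borel sets. The inverse of the subordinator is measurable
    as a first-passage time of a nondecreasing process
    ([measurable_first_passage]), and a process with continuous paths evaluated
    at a measurable random time is measurable, as a limit of its values at
    discretised times ([measurable_fun_random_time]). *)

(** * Transitivity of the rotation group on the sphere *)

(** The rotation by pi about the axis spanned by w, i.e. the opposite of the
    reflection in the plane orthogonal to w. *)
Definition half_turn (R : realType) (w : 'cV[R]_3) : 'M[R]_3 :=
  (2 / sqnorm w) *: (w *m w^T) - 1%:M.

Lemma half_turn_mul (R : realType) (w x : 'cV[R]_3) :
  half_turn w *m x = (2 / sqnorm w * (w^T *m x) ord0 ord0) *: w - x.
Proof.
rewrite /half_turn mulmxBl mul1mx -scalemxAl -mulmxA [w^T *m x]mx11_scalar.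
by rewrite mul_mx_scalar scalerA [in RHS]mxE eqxx mulr1n.
Qed.

(** The determinant of the reflection is -1, and the dimension 3 is odd. The
    proof expands the determinant; indexing the coordinates by natural numbers
    lets the indices of the minors compute. *)
Lemma det_half_turn (R : realType) (w : 'cV[R]_3) : w != 0 ->
  \det (half_turn w) = 1.
Proof.
rewrite -sqnorm_eq0 => w0.
pose u (k : nat) := w (inord k) ord0.
have wu i : w i ord0 = u i by rewrite /u inord_val.
have ws : sqnorm w = u 0 ^+ 2 + (u 1 ^+ 2 + u 2 ^+ 2).
  by rewrite /sqnorm !big_ord_recl big_ord0 !wu addr0.
have -> : half_turn w =
    \matrix_(i, j) (2 / sqnorm w * (u i * u j) - (i == j :> nat)%:R).
  by apply/matrixP => i j; rewrite !mxE big_ord_recl big_ord0 addr0 !mxE !wu.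
rewrite (expand_det_row _ ord0) !big_ord_recl big_ord0 /cofactor.
rewrite !(expand_det_row _ ord0) !big_ord_recl !big_ord0 /cofactor !det_mx11.
rewrite !mxE /= /bump /=; move: w0; rewrite ws => w0; field.
by rewrite w0.
Qed.

Lemma half_turn_subproof (R : realType) (w : 'cV[R]_3) : w != 0 ->
  half_turn w \in [set g : 'M[R]_3 | g^T *m g = 1%:M /\ \det g = 1].
Proof.
move=> w0; apply/mem_set; split; last exact: det_half_turn.
have -> : (half_turn w)^T = half_turn w.
  by rewrite /half_turn linearB /= linearZ /= trmx_mul trmxK trmx1.
have Hw : half_turn w *m w = w.
  by rewrite half_turn_mul -sqnormE divfK ?sqnorm_eq0// scaler_nat mulr2n addrK.
rewrite [X in _ *m X]/half_turn mulmxBr mulmx1 -scalemxAr mulmxA Hw.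
by rewrite /half_turn opprB addrC subrK.
Qed.

(** The half-turn about x + y sends x to y because x and y have the same norm.
    When y = - x that axis degenerates, and any axis orthogonal to x will do. *)
Lemma so3_transitive (R : realType) (x y : sphere R) :
  exists g : SO3 R, so3_act g x = y.
Proof.
have dot1 (z : sphere R) : sqnorm (val z) = 1 by case: z => z /= /set_mem.
suff [w w0 wxy] : exists2 w : 'cV[R]_3, w != 0 & half_turn w *m val x = val y.
  by exists (exist (fun g => g \in _) _ (half_turn_subproof w0)); exact/val_inj.
have [xy|xy] := eqVneq (val x + val y) 0; last first.
  exists (val x + val y) => //; rewrite half_turn_mul.
  have sE : sqnorm (val x + val y) = 2 * ((val x + val y)^T *m val x) ord0 ord0.
    have -> : sqnorm (val x + val y) = sqnorm (val x)
        + 2 * ((val y)^T *m val x) ord0 ord0 + sqnorm (val y).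
      rewrite /sqnorm mxE mulr_sumr -!big_split/=; apply: eq_bigr => i _.
      by rewrite !mxE; ring.
    have -> : ((val x + val y)^T *m val x) ord0 ord0
        = sqnorm (val x) + ((val y)^T *m val x) ord0 ord0.
      by rewrite sqnormE linearD /= mulmxDl mxE.
    by rewrite !dot1; ring.
  have -> : 2 / sqnorm (val x + val y)
      * ((val x + val y)^T *m val x) ord0 ord0 = 1.
    by rewrite mulrAC -sE divff// sqnorm_eq0.
  by rewrite scale1r addrC addKr.
have yE : val y = - val x by apply/eqP; rewrite -addr_eq0 addrC xy.
suff [w w0 wx] : exists2 w : 'cV[R]_3, w != 0 & (w^T *m val x) ord0 ord0 = 0.
  by exists w => //; rewrite half_turn_mul wx mulr0 scale0r sub0r yE.
pose u (k : nat) := val x (inord k) ord0.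
(* (u 1, - u 0, 0) is orthogonal to x; it is nonzero as soon as u 0 is, and
   otherwise the first basis vector is orthogonal to x. *)
have [u0|u0] := eqVneq (u 0) 0.
  exists (delta_mx ord0 ord0).
    apply/eqP => /matrixP/(_ ord0 ord0); rewrite !mxE/= => /eqP.
    by rewrite oner_eq0.
  rewrite trmx_delta -rowE mxE -{}[RHS]u0; congr (val x _ _).
  by apply/val_inj; rewrite /= inordK.
exists (\col_i [:: u 1; - u 0; 0]`_i).
  apply/eqP => /matrixP/(_ (inord 1) ord0); rewrite !mxE inordK//= => /eqP.
  by rewrite oppr_eq0; exact/negP.
rewrite mxE !big_ord_recl big_ord0 !mxE /= mul0r !addr0.
rewrite (_ : val x ord0 ord0 = u 0); last first.
  by congr (val x _ _); apply/val_inj; rewrite /= inordK.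
rewrite (_ : val x (lift ord0 ord0) ord0 = u 1); last first.
  by congr (val x _ _); apply/val_inj; rewrite /= inordK.
by ring.
Qed.

(** * Laws and expectations *)

(** Tonelli's theorem applied to the joint law of X and of a G-measurable
    outcome. Independence enters through a sigma-algebra G with respect to which
    T is jointly measurable: then the event {T(X) in A} is the preimage of a
    product-measurable set by w |-> (X w, w), and the sections of that set at
    the points y of E are the events {T(y) in A}. *)
Lemma prob_comp_indep (R : realType) (d dE dV : measure_display)
    (Om : measurableType d) (E : measurableType dE) (V : measurableType dV)
    (P : probability Om R) (G : set (set Om)) (X : Om -> E) (T : E -> Om -> V)
    (A : set V) (c : \bar R) :
  sigma_algebra setT G -> G `<=` measurable -> measurable_fun setT X ->
  measurable_fun [set: g_sigma_algebraType G * E] (fun p => T p.2 p.1) ->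
  (forall F B, G F -> measurable B ->
    P (F `&` X @^-1` B) = (P F * P (X @^-1` B))%E) ->
  measurable A -> (forall y, P [set w | A (T y w)] = c) ->
  P [set w | A (T (X w) w)] = c.
Proof.
move=> sG GM mX mT XG mA Ac.
(* The identity, seen as a map onto the coarser measurable space of G: its law
   is the restriction of P to G. *)
pose idG (w : Om) : g_sigma_algebraType G := w.
have GE : <<s G>> = G by exact: sigma_algebra_id.
have mid : measurable_fun setT idG.
  by move=> _ B; rewrite setTI => mB; apply: GM; rewrite -GE.
have mpair : measurable_fun setT (fun w => (X w, idG w)).
  exact: measurable_fun_pair.
pose muX := distribution P (mfun_Sub (mem_set mX)).
pose PG := distribution P (mfun_Sub (mem_set mid)).
pose joint := distribution P (mfun_Sub (mem_set mpair)).
pose S : set (E * g_sigma_algebraType G) := [set p | A (T p.1 p.2)].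
have mS : measurable S.
  have mswap :
      measurable_fun [set: E * g_sigma_algebraType G] (fun p => (p.2, p.1)).
    exact: measurable_fun_pair.
  by rewrite -[S]setTI; exact: (measurableT_comp mT mswap).
have jointE : (muX \x PG)%E S = joint S.
  apply: product_measure_unique mS => B F mB mF.
  rewrite /joint /muX /PG /distribution /pushforward/=.
  have GF : G F by rewrite -GE.
  rewrite [RHS]muleC -(XG F B GF mB).
  by congr (P _); apply/seteqP; split => w /= [].
transitivity (joint S) => //; rewrite -jointE.
transitivity (\int[muX]_(y in setT) (cst c y))%E.
  apply: eq_integral => y _; rewrite -(Ac y); congr (P _).
  by apply/seteqP; split => w; rewrite /= /xsection /= inE.
rewrite integral_cst// [X in (_ * X)%E](_ : _ = 1%E) ?mule1//.
exact: probability_setT.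
Qed.

(** The extended-real integral is by definition the difference of the integrals
    of the positive and negative parts, and each of these, finite or not,
    depends on the law alone. *)
Lemma expectation_comp_eq_law (R : realType) (d : measure_display)
    (Om : measurableType d) (P : probability Om R) (X Y : Om -> R)
    (f : R -> R) :
  measurable_fun setT X -> measurable_fun setT Y -> measurable_fun setT f ->
  (forall A, measurable A -> P (X @^-1` A) = P (Y @^-1` A)) ->
  ('E_P[fun w => f (X w)] = 'E_P[fun w => f (Y w)])%E.
Proof.
move=> mX mY mf XY; rewrite unlock.
have /measurable_EFinP mEf := mf.
suff posE (h : measurableTypeR R -> \bar R) :
    measurable_fun setT h -> (forall r, 0 <= h r)%E ->
    (\int[P]_w h (X w) = \int[P]_w h (Y w))%E.
  have posX (Z : Om -> R) :
      (fun w => (f (Z w))%:E)^\+%E = (fun w => (EFin \o f)^\+%E (Z w)).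
    by apply/funext => w; rewrite !funeposE.
  have negX (Z : Om -> R) :
      (fun w => (f (Z w))%:E)^\-%E = (fun w => (EFin \o f)^\-%E (Z w)).
    by apply/funext => w; rewrite !funenegE.
  rewrite integralE [RHS]integralE !posX !negX; congr (_ - _)%E.
    exact: (posE _ (measurable_funepos mEf) (funepos_ge0 _)).
  exact: (posE _ (measurable_funeneg mEf) (funeneg_ge0 _)).
move=> mh h0.
transitivity (\int[distribution P (mfun_Sub (mem_set mX))]_r h r)%E.
  by rewrite ge0_integral_distribution.
transitivity (\int[distribution P (mfun_Sub (mem_set mY))]_r h r)%E.
  by apply: eq_measure_integral => A mA _; exact: XY.
by rewrite ge0_integral_distribution.
Qed.

(** * Measurability of the time-changed Brownian motion *)

Lemma measurable_fun_nat_index (R : realType) (d : measure_display)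
    (Om : measurableType d) (F : nat -> Om -> R) (K : Om -> nat) :
  (forall k, measurable_fun setT (F k)) -> measurable_fun setT K ->
  measurable_fun setT (fun w => F (K w) w).
Proof.
move=> mF mK _ A mA; rewrite setTI.
rewrite (_ : _ @^-1` A = \bigcup_k (K @^-1` [set k] `&` F k @^-1` A)).
  apply: bigcupT_measurable => k; apply: measurableI.
    by rewrite -[X in measurable X]setTI; exact: mK.
  by rewrite -[X in measurable X]setTI; exact: mF.
apply/seteqP; split => [w FA|w [k _ [/= <-]]//].
by exists (K w).
Qed.

(** Rounding tau down to a multiple of 1 / N.+1 gives a random time with
    countably many values, which preserves measurability; by continuity of the
    paths the values of f at these times converge to f(tau). Rounding down keeps
    the times nonnegative, where f is controlled. *)
Lemma measurable_fun_random_time (R : realType) (d : measure_display)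
    (Om : measurableType d) (f : R -> Om -> R) (tau : Om -> R) :
  (forall s, 0 <= s -> measurable_fun setT (f s)) ->
  (forall w, {within `[0, +oo[, continuous (fun s => f s w)}) ->
  measurable_fun setT tau -> (forall w, 0 <= tau w) ->
  measurable_fun setT (fun w => f (tau w) w).
Proof.
move=> mf cf mtau tau0.
pose s_ (N : nat) (w : Om) : nat := Num.truncn (tau w * N.+1%:R).
have s_P N w : (s_ N w)%:R <= tau w * N.+1%:R < (s_ N w).+1%:R.
  by apply: truncn_itv; rewrite mulr_ge0.
apply: (@measurable_fun_cvg _ _ _ _
  (fun N w => f ((s_ N w)%:R / N.+1%:R) w)) => [N|w _].
  apply: (measurable_fun_nat_index (F := fun k => f (k%:R / N.+1%:R))) => [k|].
    by apply: mf; rewrite divr_ge0.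
  move=> _ B _; rewrite setTI.
  rewrite (_ : _ @^-1` B = \bigcup_(k in B)
     ((fun w => tau w * N.+1%:R) @^-1` `[k%:R, k.+1%:R[%classic)).
    apply: bigcup_measurable => k _; rewrite -[X in measurable X]setTI.
    exact: measurable_funM.
  apply/seteqP; split => [w Bw|w [k Bk]] /=.
    by exists (s_ N w) => //=; rewrite in_itv /=; exact: s_P.
  by rewrite in_itv/= => /truncn_def; rewrite /s_ => ->.
have tau_in : `[0, +oo[%classic (tau w) by rewrite /= in_itv/= andbT.
have /subspace_continuousP/(_ _ tau_in) := cf w; apply: cvg_trans.
have s_cvg : (s_ N w)%:R / N.+1%:R @[N --> \oo] --> tau w.
  apply: (@squeeze_cvgr _ _ _ _ (fun N => tau w - N.+1%:R^-1) (cst (tau w))).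
  - near=> N; have /andP[sl su] := s_P N w.
    rewrite ler_pdivrMr// sl andbT ler_pdivlMr// mulrBl mulVf//.
    by rewrite lerBlDr natr1 ltW.
  - rewrite -[X in _ --> X]subr0; apply: cvgB; first exact: cvg_cst.
    exact: cvg_harmonic.
  - exact: cvg_cst.
move=> U /= /s_cvg; rewrite !nbhs_simpl /=.
apply: filterS => N /=; apply.
by rewrite in_itv/= andbT divr_ge0.
Unshelve. all: by end_near. Qed.

(** The bound holds for the empty set as well, whose infimum is 0 by
    convention. *)
Lemma inf_pos_ge0 (R : realType) (P : R -> Prop) :
  0 <= inf [set tau : R | 0 < tau /\ P tau].
Proof.
have [->|S0] := eqVneq [set tau : R | 0 < tau /\ P tau] set0.
  by rewrite inf0.
by apply: lb_le_inf; [exact/set0P|move=> tau [/ltW]].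
Qed.

(** By monotonicity, level s is passed before time a exactly when it is exceeded
    at some positive rational time below a. The paths may also never pass level
    s; then the infimum is 0 by convention, so for a > 0 that event has to be
    added. It is measurable, since by monotonicity integer times detect it. *)
Lemma measurable_first_passage (R : realType) (d : measure_display)
    (Om : measurableType d) (H : R -> Om -> R) (s : R) :
  (forall t, 0 <= t -> measurable_fun setT (H t)) ->
  (forall w t u, 0 <= t -> t <= u -> H t w <= H u w) ->
  measurable_fun setT (fun w => inf [set tau : R | 0 < tau /\ s < H tau w]).
Proof.
move=> mH ndH.
pose S w := [set tau : R | 0 < tau /\ s < H tau w].
have mltH t : 0 <= t -> measurable [set w | s < H t w].
  move=> t0; have := mH _ t0 measurableT _ (measurable_itv `]s, +oo[).
  rewrite setTI; congr measurable.
  by apply/seteqP; split=> w /=; rewrite in_itv/= andbT.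
move=> _; apply: (measurability _ (RGenInftyO.measurableE R)) => //.
move=> _ [_ [a ->] <-]; rewrite setTI.
have [a0|a0] := leP a 0.
  rewrite [X in measurable X](_ : _ = set0)//; apply/seteqP; split=> // w /=.
  by rewrite in_itv/= ltNge (le_trans a0 (inf_pos_ge0 _)).
rewrite [X in measurable X](_ : _ =
  (\bigcup_(q : rat) (if 0 < (ratr q : R) < a
                      then [set w | s < H (ratr q) w] else set0)) `|`
  ~` \bigcup_(k : nat) [set w | s < H k.+1%:R w]).
  apply: measurableU.
    apply: bigcupT_measurable_rat => q; case: ifPn => // /andP[q0 _].
    exact/mltH/ltW.
  by apply: measurableC; apply: bigcupT_measurable => k; exact: mltH.
apply/seteqP; split => w /=; rewrite in_itv/=.
  have [S0|/set0P S0] := eqVneq (S w) set0.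
    move=> _; right => -[k _ /= sH].
    by have : S w k.+1%:R by []; rewrite S0.
  move=> /(inf_lt S0)[tau [tau0 sH] tau_a]; left.
  have [q] := rat_in_itvoo tau_a; rewrite in_itv/= => /andP[tauq qa].
  exists q => //=; rewrite (lt_trans tau0 tauq) qa/=.
  by rewrite (lt_le_trans sH)// ndH// ltW.
case=> [[q _]|noH].
  case: ifPn => // /andP[q0 qa] /= sH; apply: le_lt_trans qa.
  by apply: ge_inf => //; exists 0 => tau [/ltW].
rewrite (_ : [set tau | _] = set0) ?inf0//.
apply/seteqP; split=> // tau /= [tau0 sH].
apply: noH; exists (Num.truncn tau) => //=.
rewrite (lt_le_trans sH)// ndH ?ltW//.
by have /andP[] := truncn_itv (ltW tau0).
Qed.

Lemma measurable_to_sphere (R : realType) (d : measure_display)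
    (Om : measurableType d) (X : Om -> sphere R) :
  (forall i, measurable_fun setT (fun w => sphere_coord i (X w))) ->
  measurable_fun setT X.
Proof.
move=> mX; apply: (measurability _ (erefl (@sphere_measurable R))) => _ [A + <-].
rewrite -bigcup_seq => -[i _ [B mB <-]]; rewrite !setTI.
by rewrite -[X in measurable X]setTI; exact: mX.
Qed.

Lemma measurable_sphere_coord (R : realType) (i : 'I_3) :
  measurable_fun [set: sphere R] (sphere_coord i).
Proof.
move=> _ A mA; apply: sub_sigma_algebra; rewrite -bigcup_seq.
by exists i; [rewrite /= mem_index_enum|exists A].
Qed.

Lemma continuous_sphere_coord (R : realType) (i : 'I_3) :
  continuous (sphere_coord i : sphere R -> R).
Proof.
move=> x.
apply: (@continuous_comp (sphere R) 'cV[R]_3 R val (fun v => v i ord0)).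
  exact: (@initial_continuous (sphere_set R) _ set_val).
exact: coord_continuous.
Qed.

Lemma inverse_subordinator_measurable_ge0 (R : realType) (d : measure_display)
    (Om : measurableType d) (P : probability Om R) (nu : R) (L : R -> Om -> R) :
  nu <= 1 -> inverse_subordinator P nu L -> forall s, 0 <= s ->
  measurable_fun setT (L s) /\ forall w, 0 <= L s w.
Proof.
rewrite le_eqVlt => /orP[/eqP nu1 [_ /(_ nu1) LE]|
    nu1 [/(_ nu1)[H [mH _ mono _ _] LE] _]] s s0.
  by rewrite (_ : L s = cst s); [split|apply/funext => w; exact: LE].
rewrite (_ : L s = fun w => inf [set tau | 0 < tau /\ s < H tau w]); last first.
  by apply/funext => w; exact: LE.
split; last by move=> w; exact: inf_pos_ge0.
apply: measurable_first_passage => // w t u; exact: (mono w).1.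
Qed.

Lemma measurable_time_changed (R : realType) (d : measure_display)
    (Om : measurableType d) (P : probability Om R) (x : sphere R)
    (B : R -> Om -> sphere R) (L : R -> Om -> R) (t0 t : R) :
  brownian P x B -> measurable_fun setT (L (t - t0)) ->
  (forall w, 0 <= L (t - t0) w) -> measurable_fun setT (time_changed t0 B L t).
Proof.
move=> [mB _ cB _] mL L0; apply: measurable_to_sphere => i.
apply: (measurable_fun_random_time
  (f := fun s w => sphere_coord i (B s w))) => //.
  move=> s s0; exact: (measurableT_comp (measurable_sphere_coord i) (mB s s0)).
move=> w; apply: (@within_continuous_comp _ _ _ _ (B^~ w) (sphere_coord i)).
  by move=> z _; exact: continuous_sphere_coord.
exact: cB.
Qed.

(** * Isotropy and the composed field *)

Lemma isotropic_marginal (R : realType) (d : measure_display)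
    (Om : measurableType d) (P : probability Om R) (T : sphere R -> Om -> R)
    (A : set R) (x y : sphere R) : isotropic P T -> measurable A ->
  P [set w | A (T y w)] = P [set w | A (T x w)].
Proof.
move=> isoT mA; have [g <-] := so3_transitive x y.
apply: (isoT g [set f | A (f x)]); apply: sub_sigma_algebra.
by exists x => //; exists A => //; rewrite setTI.
Qed.

Theorem lemma4p2 (R : realType) (d : measure_display) (Om : measurableType d)
  (P : probability Om R) (nu t0 t : R) (n : nat)
  (T : sphere R -> Om -> R)
  (B : sphere R -> R -> Om -> sphere R)
  (L : R -> Om -> R)
  (Hnu : 0 < nu /\ nu <= 1) (Ht : 0 <= t0 /\ t0 < t)
  (T_meas : measurable_field T)
  (T_mean : zero_mean P T)
  (T_var : finite_variance P T)
  (T_iso : isotropic P T)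
  (T_weak : weakly_isotropic P n T)
  (T_spectral : spectral_representation P T)
  (B_brownian : forall x : sphere R, brownian P x (B x))
  (L_inverse : inverse_subordinator P nu L)
  (LB_indep : forall x : sphere R,
     indep_processes P `[0, +oo[ `[0, +oo[ L (B x))
  (TB_indep : forall x : sphere R,
     indep_field P `[t0, +oo[ T (time_changed t0 (B x) L)) :
  forall (x : sphere R) (g : SO3 R),
    ('E_P[fun w =>
       (composition T (fun y => time_changed t0 (B y) L) t (so3_act g x) w ^+ n)%R]
     = 'E_P[fun w => (T x w ^+ n)%R])%E.
Proof.
move=> x g; set y := so3_act g x.
have [_ /ltW t0t] := Ht.
have tt0 : 0 <= t - t0 by rewrite subr_ge0.
have [mL L0] := inverse_subordinator_measurable_ge0 Hnu.2 L_inverse tt0.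
have mX := measurable_time_changed (B_brownian y) mL L0.
have mT z : measurable_fun setT (T z) 
  by exact: (measurable_fun_pair1 _ T_meas).
have [G [sG GM mTG indepG]] := TB_indep y.
have law A : measurable A ->
    P [set w | A (T (time_changed t0 (B y) L t w) w)] = P [set w | A (T x w)].
  move=> mA.
  apply: (@prob_comp_indep _ _ _ _ _ _ _ P G (time_changed t0 (B y) L t) T)
    => //.
    move=> F C GF mC; apply: indepG => //; apply: sub_sigma_algebra.
    by exists t; [rewrite /= in_itv/= t0t|exists C => //; rewrite setTI].
  move=> z; exact: (@isotropic_marginal _ _ _ P T A x z T_iso mA).
have mTX : measurable_fun setT (fun w => T (time_changed t0 (B y) L t w) w).
  have mpair : measurable_fun setT (fun w => (w, time_changed t0 (B y) L t w)).
    exact: measurable_fun_pair.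
  exact: (measurableT_comp T_meas mpair).
by apply: (@expectation_comp_eq_law _ _ _ P _ _ (fun r : R => r ^+ n)).
Qed.
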